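(* Suppose that $K:T(E)\to E$ is a vertical connection on a differential bundle $\mathsf{q}=(q:E\to M,+_q,0_q,\lambda)$ in a tangent category. Then $c_ET(K):T^2(E)\to T(E)$ is a vertical connection on the differential bundle $T(\mathsf{q})=(T(q),T(+_q),T(0_q),T(\lambda)c)$.
   Context: Conventions: composites are written in diagrammatic order ($fg$ means first $f$, then $g$). $\langle f,g\rangle$ is the induced map into a pullback, $\pi_0,\pi_1$ are projections. Component subscripts of natural transformations are often omitted. An additive bundle over $M$ is a map $q:E\to M$ whose finite wide pullbacks $E_n$ along itself exist, with maps $+_q:E_2\to E$, $0_q:M\to E$ making $q$ a commutative monoid in the slice over $M$. An additive bundle morphism $(f_1,f_0)$ from $q:E\to M$ to $q':E'\to M'$ is a pair $f_1:E\to E'$, $f_0:M\to M'$ with $f_1q'=qf_0$ preserving addition and zero. A tangent category is a category with a functor $T$ and natural transformations $p:T\to 1$, $0:1\to T$, $+:T_2\to T$, $\ell:T\to T^2$, $c:T^2\to T^2$ such that: each $(p_M,+_M,0_M)$ is an additive bundle, the wide pullbacks $T_nM$ of $p_M$ exist and are preserved by each $T^k$; $(\ell_M,0_M)$ is an additive bundle morphism from $(p_M,+_M,0_M)$ to $(T(p_M),T(+_M),T(0_M))$; $(c_M,1)$ is an additive bundle morphism from $(T(p_M),T(+_M),T(0_M))$ to $(p_{TM},+_{TM},0_{TM})$; $c^2=1$, $\ell c=\ell$, $\ell_M\ell_{TM}=\ell_MT(\ell_M)$, $T(c)cT(c)=cT(c)c$, $\ell_{TM}T(c_M)c_{TM}=c_MT(\ell_M)$;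 and the square with top $\langle\pi_0\ell,\pi_10\rangle T(+):T_2M\to T^2M$, left $\pi_0p=\pi_1p$, right $T(p)$, bottom $0_M$ is a pullback preserved by each $T^k$. A differential bundle $\mathsf{q}=(q:E\to M,+_q,0_q,\lambda)$ is an additive bundle with a lift $\lambda:E\to T(E)$ such that: the wide pullbacks $E_n$ are preserved by each $T^k$; for all $n,m$ the pullback of $E_n\to M$ along $T_mM\to M$ exists and is preserved by each $T^k$; $(\lambda,0_M)$ is an additive bundle morphism from $q$ to $(T(q),T(+_q),T(0_q))$; $(\lambda,0_q)$ is an additive bundle morphism from $q$ to $(p_E,+_E,0_E)$; with $\mu:=\langle\pi_0\lambda,\pi_10\rangle T(+_q):E_2\to T(E)$, the square with top $\mu$, left $\pi_0q=\pi_1q:E_2\to M$, right $T(q)$, bottom $0_M$ is a pullback (preserved by each $T^k$); and $\lambda\ell_E=\lambda T(\lambda)$. Then $T(\mathsf{q})$, with lift $T(\lambda)c_E$, is again a differential bundle. A vertical connection on a differential bundle $\mathsf{q}$ is a map $K:T(E)\to E$ with $\lambda K=1_E$, $Kq=pq$, $K\lambda=\ell_ET(K)$ and $K\lambda=T(\lambda)c_ET(K)$ (i.e. a retraction of $\lambda$ that is a linear bundle morphism for both bundle structures $p_E$ and $T(q)$ on $T(E)$). *)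

(* Defs.v *)
From Stdlib Require Import ClassicalEpsilon.
From mathcomp Require Import all_boot.

Set Implicit Arguments.
Unset Strict Implicit.
Unset Printing Implicit Defensive.

Declare Scope tangent_scope.
Delimit Scope tangent_scope with tan.
Local Open Scope tangent_scope.

(* [f ;; g] is composition in diagrammatic order: first [f], then [g]. *)
Record Category := {
  obj :> Type;
  hom : obj -> obj -> Type;
  idm : forall X, hom X X;
  comp : forall X Y Z, hom X Y -> hom Y Z -> hom X Z;
  comp_idl : forall X Y (f : hom X Y), comp (idm X) f = f;
  comp_idr : forall X Y (f : hom X Y), comp f (idm Y) = f;
  comp_assoc : forall X Y Z W (f : hom X Y) (g : hom Y Z) (h : hom Z W),
    comp (comp f g) h = comp f (comp g h)
}.
Arguments hom {c} X Y.
Arguments idm {c} X.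
Arguments comp {c X Y Z} f g.

Notation "X ~> Y" := (hom X Y)
  (at level 90, right associativity) : tangent_scope.
Notation "f ;; g" := (comp f g)
  (at level 50, left associativity) : tangent_scope.

Record Functor (C D : Category) := {
  fobj :> C -> D;
  fmap : forall X Y : C, (X ~> Y) -> (fobj X ~> fobj Y);
  fmap_id : forall X : C, fmap (idm X) = idm (fobj X);
  fmap_comp : forall (X Y Z : C) (f : X ~> Y) (g : Y ~> Z),
    fmap (f ;; g) = fmap f ;; fmap g
}.
Arguments fmap {C D} F {X Y} f : rename.

Definition functor_id (C : Category) : Functor C C :=
  {| fobj X := X; fmap X Y f := f;
     fmap_id X := erefl; fmap_comp X Y Z f g := erefl |}.

(* First [F], then [G]. *)
Definition functor_comp (B C D : Category) (F : Functor B C) (G : Functor C D) :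
  Functor B D.
Proof.
refine {| fobj X := G (F X); fmap X Y f := fmap G (fmap F f) |}.
- by move=> X; rewrite !fmap_id.
- by move=> X Y Z f g; rewrite !fmap_comp.
Defined.

Fixpoint functor_iter (C : Category) (F : Functor C C) (k : nat) : Functor C C :=
  if k is k'.+1 then functor_comp F (functor_iter F k') else functor_id C.

(*    P --t--> A
      |l       |r
      B --b--> D   *)
Definition is_pullback (C : Category) (P A B D : C)
    (t : P ~> A) (l : P ~> B) (r : A ~> D) (b : B ~> D) : Prop :=
  t ;; r = l ;; b /\
  forall (X : C) (x : X ~> A) (y : X ~> B), x ;; r = y ;; b ->
    exists! h : X ~> P, h ;; t = x /\ h ;; l = y.

Definition is_pullback_preserved_by_powers (C : Category) (F : Functor C C)
    (P A B D : C) (t : P ~> A) (l : P ~> B) (r : A ~> D) (b : B ~> D) : Prop :=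
  forall k, let Fk := functor_iter F k in
    is_pullback (fmap Fk t) (fmap Fk l) (fmap Fk r) (fmap Fk b).

(* Cones over [n] copies of [q]; for [n = 0] such a cone is just a map to [M]
   and its limit is [M] itself. *)
Record WideCone (C : Category) (E M : C) (q : E ~> M) (n : nat) := {
  apex : C;
  base : apex ~> M;
  proj : 'I_n -> (apex ~> E);
  proj_base : forall i, proj i ;; q = base
}.

Definition is_wide_pullback (C : Category) (E M : C) (q : E ~> M) (n : nat)
    (W : WideCone q n) : Prop :=
  forall (X : C) (b : X ~> M) (f : 'I_n -> (X ~> E)),
    (forall i, f i ;; q = b) ->
    exists! h : X ~> apex W, h ;; base W = b /\ forall i, h ;; proj W i = f i.

Definition map_cone (C D : Category) (F : Functor C D) (E M : C) (q : E ~> M)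
    (n : nat) (W : WideCone q n) : WideCone (fmap F q) n.
Proof.
refine {| apex := F (apex W); base := fmap F (base W);
          proj i := fmap F (proj W i) |}.
by move=> i; rewrite -fmap_comp proj_base.
Defined.

Definition ord2_0 : 'I_2 := @Ordinal 2 0 isT.
Definition ord2_1 : 'I_2 := @Ordinal 2 1 isT.
Definition ord3_0 : 'I_3 := @Ordinal 3 0 isT.
Definition ord3_1 : 'I_3 := @Ordinal 3 1 isT.
Definition ord3_2 : 'I_3 := @Ordinal 3 2 isT.

Lemma ord2_ind (P : 'I_2 -> Prop) : P ord2_0 -> P ord2_1 -> forall i, P i.
Proof.
move=> h0 h1 [[|[|//]] hi].
- by rewrite (_ : Ordinal hi = ord2_0) //; apply: val_inj.
- by rewrite (_ : Ordinal hi = ord2_1) //; apply: val_inj.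
Qed.

Section Induced.
Variables (C : Category) (E M : C) (q : E ~> M).

Definition induced n (W : WideCone q n) (lim : is_wide_pullback W) X
    (b : X ~> M) (f : 'I_n -> (X ~> E)) (e : forall i, f i ;; q = b) :
  X ~> apex W :=
  proj1_sig (constructive_definite_description _ (lim X b f e)).

Lemma induced_base n (W : WideCone q n) (lim : is_wide_pullback W) X
    (b : X ~> M) (f : 'I_n -> (X ~> E)) (e : forall i, f i ;; q = b) :
  induced lim e ;; base W = b.
Proof. by rewrite /induced; case: constructive_definite_description => h []. Qed.

Lemma induced_proj n (W : WideCone q n) (lim : is_wide_pullback W) X
    (b : X ~> M) (f : 'I_n -> (X ~> E)) (e : forall i, f i ;; q = b) i :
  induced lim e ;; proj W i = f i.
Proof. by rewrite /induced; case: constructive_definite_description => h []. Qed.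

Lemma wide_pullback_ext n (W : WideCone q n) (lim : is_wide_pullback W) X
    (h h' : X ~> apex W) :
  h ;; base W = h' ;; base W ->
  (forall i, h ;; proj W i = h' ;; proj W i) -> h = h'.
Proof.
move=> eb ei.
have hq i : (h' ;; proj W i) ;; q = h' ;; base W by rewrite comp_assoc proj_base.
have [k [_ uk]] := lim X (h' ;; base W) (fun i => h' ;; proj W i) hq.
by rewrite -(uk h) // -(uk h').
Qed.

Variables (W : WideCone q 2) (lim : is_wide_pullback W).

Lemma proj_eq i j : proj W i ;; q = proj W j ;; q.
Proof. by rewrite !proj_base. Qed.

Definition pair_family X (f g : X ~> E) (i : 'I_2) : X ~> E :=
  if val i is 0 then f else g.

Lemma pair_familyP X (f g : X ~> E) (e : f ;; q = g ;; q) i :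
  pair_family f g i ;; q = f ;; q.
Proof. by elim/ord2_ind: i. Qed.

(* The map <f, g> into the pullback of [q] along itself. *)
Definition pairing X (f g : X ~> E) (e : f ;; q = g ;; q) : X ~> apex W :=
  induced lim (pair_familyP e).

Lemma pairing_proj0 X (f g : X ~> E) (e : f ;; q = g ;; q) :
  pairing e ;; proj W ord2_0 = f.
Proof. exact: induced_proj. Qed.

Lemma pairing_proj1 X (f g : X ~> E) (e : f ;; q = g ;; q) :
  pairing e ;; proj W ord2_1 = g.
Proof. exact: induced_proj. Qed.

Lemma pairing_base X (f g : X ~> E) (e : f ;; q = g ;; q) :
  pairing e ;; base W = f ;; q.
Proof. exact: induced_base. Qed.

Lemma pair_ext X (h h' : X ~> apex W) :
  h ;; proj W ord2_0 = h' ;; proj W ord2_0 ->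
  h ;; proj W ord2_1 = h' ;; proj W ord2_1 -> h = h'.
Proof.
move=> e0 e1; apply: (wide_pullback_ext lim); last by elim/ord2_ind.
by rewrite -(proj_base W ord2_0) -!comp_assoc e0.
Qed.

End Induced.
Arguments pairing {C E M q W} lim {X f g} e.

(* Chosen finite wide pullbacks [E_n], with an addition and a zero over [M]. *)
Record AdditiveStructure (C : Category) (E M : C) (q : E ~> M) := {
  pow : forall n, WideCone q n;
  pow_lim : forall n, is_wide_pullback (pow n);
  add : apex (pow 2) ~> E;
  zero : M ~> E;
  add_over : add ;; q = base (pow 2);
  zero_over : zero ;; q = idm M
}.
Arguments pow {C E M q} A n : rename.
Arguments pow_lim {C E M q} A n : rename.
Arguments add {C E M q} A : rename.
Arguments zero {C E M q} A : rename.

Section CommutativeMonoid.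
Variables (C : Category) (E M : C) (q : E ~> M) (A : AdditiveStructure q).

(* <a, b> followed by the addition. *)
Definition sum X (a b : X ~> E) (e : a ;; q = b ;; q) : X ~> E :=
  pairing (pow_lim A 2) e ;; add A.

Lemma sum_over X (a b c : X ~> E) (e : a ;; q = b ;; q) (e' : a ;; q = c ;; q) :
  sum e ;; q = c ;; q.
Proof. by rewrite /sum comp_assoc add_over pairing_base. Qed.

Lemma sum_over' X (a b c : X ~> E) (e : b ;; q = c ;; q) (e' : a ;; q = b ;; q) :
  a ;; q = sum e ;; q.
Proof. by rewrite /sum comp_assoc add_over pairing_base. Qed.

Lemma zero_compat : idm E ;; q = (q ;; zero A) ;; q.
Proof. by rewrite comp_assoc zero_over comp_idl comp_idr. Qed.

Lemma pow_proj_eq n i j : proj (pow A n) i ;; q = proj (pow A n) j ;; q.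
Proof. by rewrite !proj_base. Qed.

Definition is_commutative_monoid : Prop :=
  [/\ sum (sum_over (pow_proj_eq ord3_0 ord3_1) (pow_proj_eq ord3_0 ord3_2))
        = sum (sum_over' (pow_proj_eq ord3_1 ord3_2) (pow_proj_eq ord3_0 ord3_1)),
      sum (pow_proj_eq ord2_1 ord2_0) = add A
    & sum zero_compat = idm E].

End CommutativeMonoid.

Record AdditiveBundle (C : Category) (E M : C) (q : E ~> M) := {
  additive_structure :> AdditiveStructure q;
  additive_monoid : is_commutative_monoid additive_structure
}.

Section AdditiveMorphism.
Variables (C : Category) (E M E' M' : C) (q : E ~> M) (q' : E' ~> M').
Variables (A : AdditiveBundle q) (A' : AdditiveBundle q').
Variables (f1 : E ~> E') (f0 : M ~> M').

Lemma pow2_map_compat (sq : f1 ;; q' = q ;; f0) :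
  (proj (pow A 2) ord2_0 ;; f1) ;; q' = (proj (pow A 2) ord2_1 ;; f1) ;; q'.
Proof. by rewrite !comp_assoc !sq -!comp_assoc (pow_proj_eq A ord2_0 ord2_1). Qed.

Definition pow2_map (sq : f1 ;; q' = q ;; f0) : apex (pow A 2) ~> apex (pow A' 2) :=
  pairing (pow_lim A' 2) (pow2_map_compat sq).

Definition is_additive_morphism : Prop :=
  exists sq : f1 ;; q' = q ;; f0,
    add A ;; f1 = pow2_map sq ;; add A' /\ zero A ;; f1 = f0 ;; zero A'.

Lemma is_additive_morphism_square : is_additive_morphism -> f1 ;; q' = q ;; f0.
Proof. by case. Qed.

Lemma is_additive_morphismP :
  is_additive_morphism <->
  [/\ f1 ;; q' = q ;; f0,
      forall h : apex (pow A 2) ~> apex (pow A' 2),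
        h ;; proj (pow A' 2) ord2_0 = proj (pow A 2) ord2_0 ;; f1 ->
        h ;; proj (pow A' 2) ord2_1 = proj (pow A 2) ord2_1 ;; f1 ->
        add A ;; f1 = h ;; add A'
    & zero A ;; f1 = f0 ;; zero A'].
Proof.
split=> [[sq [ha hz]]|[sq ha hz]].
  split=> // h h0 h1; rewrite ha; congr (_ ;; _).
  by apply: (pair_ext (pow_lim A' 2)); rewrite ?pairing_proj0 ?pairing_proj1 ?h0 ?h1.
exists sq; split=> //; apply: ha; [exact: pairing_proj0|exact: pairing_proj1].
Qed.

End AdditiveMorphism.

Section MapAdditive.
Variables (C D : Category) (F : Functor C D) (E M : C) (q : E ~> M).

Definition map_structure (A : AdditiveStructure q)
    (pres : forall n, is_wide_pullback (map_cone F (pow A n))) :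
  AdditiveStructure (fmap F q).
Proof.
refine {| pow n := map_cone F (pow A n); pow_lim := pres;
          add := fmap F (add A); zero := fmap F (zero A) |}.
- by rewrite -fmap_comp add_over.
- by rewrite -fmap_comp zero_over fmap_id.
Defined.

Lemma map_sum (A : AdditiveStructure q)
    (pres : forall n, is_wide_pullback (map_cone F (pow A n)))
    X (a b : X ~> E) (e : a ;; q = b ;; q)
    (a' b' : F X ~> F E) (e' : a' ;; fmap F q = b' ;; fmap F q) :
  fmap F a = a' -> fmap F b = b' ->
  sum (map_structure pres) e' = fmap F (sum A e).
Proof.
move=> ea eb; rewrite /sum fmap_comp; congr (_ ;; _).
apply: (pair_ext (pres 2)); rewrite /= -?fmap_comp.
  by rewrite pairing_proj0 (pairing_proj0 (pres 2)).
by rewrite pairing_proj1 (pairing_proj1 (pres 2)).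
Qed.

Definition map_additive (A : AdditiveBundle q)
    (pres : forall n, is_wide_pullback (map_cone F (pow A n))) :
  AdditiveBundle (fmap F q).
Proof.
exists (map_structure pres).
have [hA hC h0] := additive_monoid A.
split.
- rewrite (map_sum pres (sum_over A (pow_proj_eq A ord3_0 ord3_1)
     (pow_proj_eq A ord3_0 ord3_2))) //; last first.
    by symmetry; apply: map_sum.
  rewrite hA; symmetry; apply: map_sum => //.
  by symmetry; apply: map_sum.
- rewrite -[RHS]/(fmap F (add A)) -hC; exact: map_sum.
- transitivity (fmap F (sum A (zero_compat A))); last by rewrite h0 fmap_id.
  by apply: map_sum; [exact: fmap_id|exact: fmap_comp].
Defined.

End MapAdditive.

(* The part of a tangent structure needed to state the other axioms.  [0_M],
   [+_M] and the wide pullbacks [T_n M] are components of [p_bundle M];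
   [p_bundle_natural] amounts to the naturality of [0] and [+]. *)
Record TangentFunctor (C : Category) := {
  endofunctor :> Functor C C;
  p : forall M, endofunctor M ~> M;
  p_natural : forall (M N : C) (f : M ~> N), fmap endofunctor f ;; p N = p M ;; f;
  p_bundle : forall M, AdditiveBundle (p M);
  p_bundle_natural : forall (M N : C) (f : M ~> N),
    is_additive_morphism (p_bundle M) (p_bundle N) (fmap endofunctor f) f;
  p_bundle_preserved : forall k M n,
    is_wide_pullback (map_cone (functor_iter endofunctor k) (pow (p_bundle M) n))
}.
Arguments p {C} t M : rename.
Arguments p_bundle {C} t M : rename.
Arguments p_bundle_preserved {C} t k M n : rename.

Section TangentFunctorTheory.
Variables (C : Category) (T : TangentFunctor C).

Definition tzero (M : C) : M ~> T M := zero (p_bundle T M).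

Definition preserved_by_powers (E M : C) (q : E ~> M) (A : AdditiveBundle q) :
    Prop :=
  forall k n, is_wide_pullback (map_cone (functor_iter T k) (pow A n)).

Lemma preserved1 (E M : C) (q : E ~> M) (A : AdditiveBundle q) :
  preserved_by_powers A -> forall n, is_wide_pullback (map_cone T (pow A n)).
Proof. exact: (fun pres n => pres 1 n). Qed.

Definition T_additive (E M : C) (q : E ~> M) (A : AdditiveBundle q)
    (pres : preserved_by_powers A) : AdditiveBundle (fmap T q) :=
  map_additive (preserved1 pres).

Lemma p_preserved M : preserved_by_powers (p_bundle T M).
Proof. by move=> k n; exact: p_bundle_preserved. Qed.

Lemma tzero_natural (M N : C) (f : M ~> N) : tzero M ;; fmap T f = f ;; tzero N.
Proof. by have [_ [_]] := p_bundle_natural T f. Qed.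

Section Mu.
Variables (E M : C) (q : E ~> M) (A : AdditiveBundle q).
Variables (pres : preserved_by_powers A) (lam : E ~> T E).
Hypothesis lam_over : lam ;; fmap T q = q ;; tzero M.

Lemma mu_compat :
  (proj (pow A 2) ord2_0 ;; lam) ;; fmap T q
  = (proj (pow A 2) ord2_1 ;; tzero E) ;; fmap T q.
Proof.
by rewrite !comp_assoc lam_over tzero_natural -!comp_assoc
  (pow_proj_eq A ord2_0 ord2_1).
Qed.

(* <pi_0 lam, pi_1 0> T(+_q); the pairing is into T(E_2), the pullback of T(q)
   along itself. *)
Definition mu : apex (pow A 2) ~> T E :=
  pairing (pow_lim (T_additive pres) 2) mu_compat ;; fmap T (add A).

Definition is_universal_lift : Prop :=
  is_pullback_preserved_by_powers T
    mu (proj (pow A 2) ord2_0 ;; q) (fmap T q) (tzero M).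

End Mu.
End TangentFunctorTheory.

Arguments p_preserved {C} T M : rename.

Record TangentCategory := {
  tcat :> Category;
  T : TangentFunctor tcat;
  l : forall M, T M ~> T (T M);
  c : forall M, T (T M) ~> T (T M);
  l_natural : forall (M N : tcat) (f : M ~> N),
    fmap T f ;; l N = l M ;; fmap T (fmap T f);
  c_natural : forall (M N : tcat) (f : M ~> N),
    fmap T (fmap T f) ;; c N = c M ;; fmap T (fmap T f);
  l_additive : forall M, is_additive_morphism
    (p_bundle T M) (T_additive (p_preserved T M)) (l M) (tzero T M);
  c_additive : forall M, is_additive_morphism
    (T_additive (p_preserved T M)) (p_bundle T (T M)) (c M) (idm (T M));
  c_c : forall M, c M ;; c M = idm (T (T M));
  l_c : forall M, l M ;; c M = l M;
  l_l : forall M, l M ;; l (T M) = l M ;; fmap T (l M);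
  c_c_c : forall M,
    fmap T (c M) ;; c (T M) ;; fmap T (c M) = c (T M) ;; fmap T (c M) ;; c (T M);
  l_c_c : forall M, l (T M) ;; fmap T (c M) ;; c (T M) = c M ;; fmap T (l M);
  l_universal : forall M,
    is_universal_lift (p_preserved T M) (is_additive_morphism_square (l_additive M))
}.
Arguments T {t} : rename.
Arguments l {t} M : rename.
Arguments c {t} M : rename.

Record DifferentialBundle (X : TangentCategory) := {
  total : X;
  basis : X;
  q : total ~> basis;
  q_bundle : AdditiveBundle q;
  lam : total ~> T total;
  q_preserved : preserved_by_powers T q_bundle;
  q_pullbacks : forall n m, exists (P : X)
    (u : P ~> apex (pow q_bundle n)) (v : P ~> apex (pow (p_bundle T basis) m)),
    is_pullback_preserved_by_powers T
      u v (base (pow q_bundle n)) (base (pow (p_bundle T basis) m));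
  lam_additive_T :
    is_additive_morphism q_bundle (T_additive q_preserved) lam (tzero T basis);
  lam_additive_p :
    is_additive_morphism q_bundle (p_bundle T total) lam (zero q_bundle);
  lam_universal :
    is_universal_lift q_preserved (is_additive_morphism_square lam_additive_T);
  lam_l : lam ;; l total = lam ;; fmap T lam
}.
Arguments q {X} d : rename.
Arguments q_bundle {X} d : rename.
Arguments lam {X} d : rename.
Arguments q_preserved {X} d : rename.

Section PullbackIso.
Variable C : Category.

Lemma is_pullback_iso (P A B D A' B' D' : C)
    (t : P ~> A) (s : P ~> B) (r : A ~> D) (b : B ~> D)
    (f : A ~> A') (f' : A' ~> A) (g : B ~> B') (g' : B' ~> B)
    (d : D ~> D') (d' : D' ~> D) (r' : A' ~> D') (b' : B' ~> D') :
  f ;; f' = idm A -> f' ;; f = idm A' ->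
  g ;; g' = idm B -> g' ;; g = idm B' -> d ;; d' = idm D ->
  f ;; r' = r ;; d -> g ;; b' = b ;; d ->
  is_pullback t s r b -> is_pullback (t ;; f) (s ;; g) r' b'.
Proof.
move=> ff f'f gg g'g dd fr gb [sq univ]; split.
  by rewrite !comp_assoc fr gb -!comp_assoc sq.
move=> X x y xy.
have er : f' ;; r = r' ;; d'.
  by rewrite -[r]comp_idr -dd -(comp_assoc r) -fr -!comp_assoc f'f comp_idl.
have eb : g' ;; b = b' ;; d'.
  by rewrite -[b]comp_idr -dd -(comp_assoc b) -gb -!comp_assoc g'g comp_idl.
have [|h [[hx hy] uh]] := univ X (x ;; f') (y ;; g').
  by rewrite !comp_assoc er eb -!comp_assoc xy.
exists h; split.
  by rewrite -!comp_assoc hx hy !comp_assoc f'f g'g !comp_idr.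
move=> k [kx ky]; apply: uh; rewrite -kx -ky !comp_assoc ff gg !comp_idr.
by [].
Qed.

Lemma preserved_pullback_iso (F : Functor C C) (P A B D A' B' D' : C)
    (t : P ~> A) (s : P ~> B) (r : A ~> D) (b : B ~> D)
    (f : A ~> A') (f' : A' ~> A) (g : B ~> B') (g' : B' ~> B)
    (d : D ~> D') (d' : D' ~> D) (r' : A' ~> D') (b' : B' ~> D') :
  f ;; f' = idm A -> f' ;; f = idm A' ->
  g ;; g' = idm B -> g' ;; g = idm B' -> d ;; d' = idm D ->
  f ;; r' = r ;; d -> g ;; b' = b ;; d ->
  is_pullback_preserved_by_powers F t s r b ->
  is_pullback_preserved_by_powers F (t ;; f) (s ;; g) r' b'.
Proof.
move=> ff f'f gg g'g dd fr gb H k Fk; rewrite /Fk !fmap_comp.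
apply: (is_pullback_iso (f' := fmap Fk f') (g' := fmap Fk g') (d := fmap Fk d)
  (d' := fmap Fk d') _ _ _ _ _ _ _ (H k)); rewrite -!fmap_comp -?fmap_id.
all: by congr fmap.
Qed.

Lemma preserved_pullback_map (F : Functor C C) (P A B D : C)
    (t : P ~> A) (s : P ~> B) (r : A ~> D) (b : B ~> D) :
  is_pullback_preserved_by_powers F t s r b ->
  is_pullback_preserved_by_powers F (fmap F t) (fmap F s) (fmap F r) (fmap F b).
Proof. by move=> H k; exact: H k.+1. Qed.

End PullbackIso.

Section TangentOfDifferentialBundle.
Variables (X : TangentCategory) (B : DifferentialBundle X).

Local Notation E := (total B).
Local Notation M := (basis B).
Local Notation A := (q_bundle B).
Local Notation TA := (T_additive (q_preserved B)).
Local Notation tlam := (fmap T (lam B) ;; c E).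

Lemma c_p (N : X) : c N ;; p T (T N) = fmap T (p T N).
Proof. by have [sq _] := c_additive N; rewrite sq comp_idr. Qed.

Lemma Tzero_c (N : X) : fmap T (tzero T N) ;; c N = tzero T (T N).
Proof. by have [_ [_]] := c_additive N; rewrite comp_idl. Qed.

Lemma T_preserved : preserved_by_powers T TA.
Proof. by move=> k n; exact: (q_preserved B k.+1 n). Qed.

(* The isomorphism between T(T_m N) and T_m(T N) induced by [c]. *)
Lemma Tpow_iso (N : X) m :
  exists (f : T (apex (pow (p_bundle T N) m)) ~> apex (pow (p_bundle T (T N)) m))
         (f' : apex (pow (p_bundle T (T N)) m) ~> T (apex (pow (p_bundle T N) m))),
  [/\ f ;; f' = idm _, f' ;; f = idm _ &
      f ;; base (pow (p_bundle T (T N)) m) = fmap T (base (pow (p_bundle T N) m))].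
Proof.
set W := pow (p_bundle T N) m; set W' := pow (p_bundle T (T N)) m.
have limW' : is_wide_pullback W' by exact: pow_lim.
have limW : is_wide_pullback (map_cone T W) by exact: (preserved1 (p_preserved T N)).
have ef i : (fmap T (proj W i) ;; c N) ;; p T (T N) = fmap T (base W).
  by rewrite comp_assoc c_p -fmap_comp proj_base.
have ef' i : (proj W' i ;; c N) ;; fmap T (p T N) = base W'.
  by rewrite -c_p comp_assoc -(comp_assoc (c N)) c_c comp_idl proj_base.
pose f := induced limW' ef; pose f' := induced limW ef'.
have f'p i : f' ;; fmap T (proj W i) = proj W' i ;; c N.
  exact: (induced_proj limW ef' i).
have f'b : f' ;; fmap T (base W) = base W' by exact: (induced_base limW ef').
have fp i : f ;; proj W' i = fmap T (proj W i) ;; c N by exact: induced_proj.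
have fb : f ;; base W' = fmap T (base W) by exact: induced_base.
exists f, f'; split=> //.
- apply: (wide_pullback_ext limW) => [|i] /=; rewrite comp_idl comp_assoc.
    by rewrite f'b.
  by rewrite f'p -comp_assoc fp comp_assoc c_c comp_idr.
- apply: (wide_pullback_ext limW') => [|i]; rewrite comp_idl comp_assoc.
    by rewrite fb.
  by rewrite fp -comp_assoc f'p comp_assoc c_c comp_idr.
Qed.

Lemma T_pullbacks n m : exists (P : X)
    (u : P ~> apex (pow TA n)) (v : P ~> apex (pow (p_bundle T (T M)) m)),
    is_pullback_preserved_by_powers T
      u v (base (pow TA n)) (base (pow (p_bundle T (T M)) m)).
Proof.
have [P [u [v pb]]] := q_pullbacks B n m.
have [f [f' [ff f'f fb]]] := Tpow_iso M m.
exists (T P), (fmap T u ;; idm _), (fmap T v ;; f).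
apply: (preserved_pullback_iso (f' := idm _) (g' := f') (d := idm _) (d' := idm _)
  _ _ ff f'f _ _ _ (preserved_pullback_map pb)); rewrite ?comp_idl ?comp_idr //.
Qed.

Lemma tlam_over : tlam ;; fmap T (fmap T (q B)) = fmap T (q B) ;; tzero T (T M).
Proof.
have sq := is_additive_morphism_square (lam_additive_T B).
by rewrite comp_assoc -c_natural -comp_assoc -fmap_comp sq fmap_comp comp_assoc Tzero_c.
Qed.

Lemma tlam_additive_T :
  is_additive_morphism TA (T_additive T_preserved) tlam (tzero T (T M)).
Proof.
apply/is_additive_morphismP; have [sq [ha hz]] := lam_additive_T B.
split; first exact: tlam_over.
- move=> h h0 h1 /=.
  rewrite -comp_assoc -fmap_comp ha fmap_comp comp_assoc c_natural -comp_assoc.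
  congr (_ ;; _); apply: (pair_ext (pow_lim (T_additive T_preserved) 2)) => /=.
    rewrite comp_assoc -c_natural -comp_assoc -fmap_comp.
    by rewrite (pairing_proj0 (pow_lim TA 2)) fmap_comp comp_assoc; exact: (esym h0).
  rewrite comp_assoc -c_natural -comp_assoc -fmap_comp.
  by rewrite (pairing_proj1 (pow_lim TA 2)) fmap_comp comp_assoc; exact: (esym h1).
- rewrite /= -comp_assoc -fmap_comp hz /= fmap_comp comp_assoc c_natural.
  by rewrite -comp_assoc Tzero_c.
Qed.

Lemma tlam_additive_p :
  is_additive_morphism TA (p_bundle T (T E)) tlam (zero TA).
Proof.
apply/is_additive_morphismP; have [sq [ha hz]] := lam_additive_p B.
split.
- by rewrite comp_assoc c_p -!fmap_comp sq.
- move=> h h0 h1 /=.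
  rewrite -comp_assoc -fmap_comp ha fmap_comp comp_assoc.
  have [csq [hca _]] := c_additive E.
  rewrite -[_ ;; c E]/(add (T_additive (p_preserved T E)) ;; c E) hca -comp_assoc.
  congr (_ ;; _); apply: (pair_ext (pow_lim (p_bundle T (T E)) 2)).
    rewrite h0 comp_assoc pairing_proj0 /= -comp_assoc -fmap_comp.
    by rewrite pairing_proj0 fmap_comp comp_assoc.
  rewrite h1 comp_assoc pairing_proj1 /= -comp_assoc -fmap_comp.
  by rewrite pairing_proj1 fmap_comp comp_assoc.
- rewrite /= -comp_assoc -fmap_comp hz fmap_comp comp_assoc.
  by rewrite Tzero_c.
Qed.

Lemma tlam_universal :
  is_universal_lift T_preserved (is_additive_morphism_square tlam_additive_T).
Proof.
have := preserved_pullback_map (lam_universal B).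
rewrite /is_universal_lift.
set m := mu _ _; set s := _ ;; q B; set m' := mu _ _ => pb.
have em : m' = fmap T m ;; c E.
  rewrite /m /m' /mu fmap_comp [RHS]comp_assoc c_natural -[RHS]comp_assoc.
  congr (_ ;; _); apply: (pair_ext (pow_lim (T_additive T_preserved) 2)).
    apply: etrans (pairing_proj0 (pow_lim (T_additive T_preserved) 2) _) _ => /=.
    rewrite [RHS]comp_assoc -c_natural -!comp_assoc -!fmap_comp.
    by rewrite (pairing_proj0 (pow_lim TA 2)).
  apply: etrans (pairing_proj1 (pow_lim (T_additive T_preserved) 2) _) _ => /=.
  rewrite [RHS]comp_assoc -c_natural -[RHS]comp_assoc -!fmap_comp.
  by rewrite (pairing_proj1 (pow_lim TA 2)) fmap_comp comp_assoc Tzero_c.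
rewrite em /= -fmap_comp -[fmap T (_ ;; q B)]comp_idr.
apply: (preserved_pullback_iso (f' := c E) (g' := idm _) (d := c M) (d' := c M)
  _ _ _ _ _ _ _ pb); rewrite ?c_c ?comp_idl ?comp_idr ?Tzero_c //.
by rewrite c_natural.
Qed.

Lemma tlam_l : tlam ;; l (T E) = tlam ;; fmap T tlam.
Proof.
have cl : c E ;; l (T E) = fmap T (l E) ;; c (T E) ;; fmap T (c E).
  have e : fmap T (l E) = c E ;; l (T E) ;; fmap T (c E) ;; c (T E).
    by rewrite !comp_assoc -(comp_assoc (l _)) l_c_c -comp_assoc c_c comp_idl.
  rewrite e !comp_assoc -(comp_assoc (c (T E))) c_c comp_idl.
  by rewrite -fmap_comp c_c fmap_id comp_idr.
rewrite fmap_comp !comp_assoc cl -(comp_assoc (c E)) -c_natural.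
by rewrite -!comp_assoc -!fmap_comp lam_l.
Qed.

Definition T_differential_bundle : DifferentialBundle X := {|
  total := T E;
  basis := T M;
  q := fmap T (q B);
  q_bundle := TA;
  lam := tlam;
  q_preserved := T_preserved;
  q_pullbacks := T_pullbacks;
  lam_additive_T := tlam_additive_T;
  lam_additive_p := tlam_additive_p;
  lam_universal := tlam_universal;
  lam_l := tlam_l
|}.

End TangentOfDifferentialBundle.

Record is_vertical_connection (X : TangentCategory) (B : DifferentialBundle X)
    (K : T (total B) ~> total B) : Prop := {
  K_retraction : lam B ;; K = idm (total B);
  K_over : K ;; q B = p T (total B) ;; q B;
  K_linear_p : K ;; lam B = l (total B) ;; fmap T K;
  K_linear_T : K ;; lam B = fmap T (lam B) ;; c (total B) ;; fmap T K
}.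
Arguments is_vertical_connection {X} B K.

(* Main.v *)
Require Import Defs.
From mathcomp Require Import ssreflect.

Local Open Scope tangent_scope.

(** Every axiom for [c ;; T(K)] is the image under [T] of the corresponding
    axiom for [K], conjugated by the flip [c]: the flip turns the structure
    maps [p], [l], [c] of [E] with [T] applied to them into those of [T(E)].
    The retraction needs only that [c] is an involution, and the square over
    the base needs [c ;; T(p) = p_T].  Linearity for [p] rests on
    [l_T ;; T(c) = c ;; T(l) ;; c], a rearrangement of the compatibility of the
    lift with the flip, and linearity for [T(q)] on the Yang-Baxter equation
    for [c]. *)

(** As [c] is an involution, the axiom [c ;; p_T = T(p)] reads both ways. *)
Lemma flip_Tp (X : TangentCategory) (N : X) :
  c N ;; fmap T (p T N) = p T (T N).
Proof. by rewrite -c_p -comp_assoc c_c comp_idl. Qed.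

(** Cancels the outer flip of [l_T ;; T(c) ;; c = c ;; T(l)]. *)
Lemma lift_Tflip (X : TangentCategory) (N : X) :
  l (T N) ;; fmap T (c N) = c N ;; fmap T (l N) ;; c (T N).
Proof. by rewrite -l_c_c comp_assoc c_c comp_idr. Qed.

Theorem proposition3p8 (X : TangentCategory) (B : DifferentialBundle X)
    (K : T (total B) ~> total B) :
  is_vertical_connection B K ->
  is_vertical_connection (T_differential_bundle B) (c (total B) ;; fmap T K).
Proof.
case=> K_retr K_over K_lin_p K_lin_T; split=> /=.
- by rewrite comp_assoc -(comp_assoc (c _)) c_c comp_idl -fmap_comp K_retr fmap_id.
- by rewrite comp_assoc -fmap_comp K_over fmap_comp -comp_assoc flip_Tp.
- rewrite comp_assoc -(comp_assoc (fmap T K)) -fmap_comp K_lin_p.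
  by rewrite !fmap_comp -(comp_assoc (l _)) lift_Tflip !comp_assoc c_natural.
- rewrite comp_assoc -(comp_assoc (fmap T K)) -fmap_comp K_lin_T.
  rewrite !fmap_comp !comp_assoc c_natural.
  (* Both sides now differ by moving [T(T(lam))] past the leftmost flip and one
     use of the Yang-Baxter equation. *)
  rewrite -(comp_assoc (c (total B))) -c_natural !comp_assoc.
  congr (_ ;; _); rewrite -!comp_assoc.
  by congr (_ ;; _); rewrite c_c_c.
Qed.
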